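(* Let $p, q \ge 1$ be integers and let $G$ be the line graph of the subdivision graph of the 2D-lattice of $TUC_4C_8[p,q]$. Then the F-index of $G$ is $F(G) = 324pq - 130p - 130q$.
   Context: For a simple graph $H$, $d(u)$ denotes the degree of a vertex $u$ in $H$. The F-index of $H$ is $F(H) = \sum_{u \in V(H)} d^3(u) = \sum_{uv \in E(H)} [d^2(u)+d^2(v)]$. The subdivision graph $S(H)$ is the graph obtained from $H$ by inserting one additional vertex into each edge of $H$ (each edge is replaced by a path of length 2). The line graph $L(H)$ is the simple graph whose vertices are the edges of $H$, two distinct ones being adjacent when they share a common endpoint in $H$. The 2D-lattice of $TUC_4C_8[p,q]$, where $p$ is the number of squares in a row and $q$ the number of rows of squares, is the following graph of order $4pq$ and size $6pq-p-q$. For each $(i,j)$ with $1\le i\le p$, $1\le j\le q$ there is a square (4-cycle) with vertices $\ell_{i,j}, t_{i,j}, r_{i,j}, b_{i,j}$ (left, top, right, bottom) in this cyclic order; in addition $r_{i,j}$ is adjacent to $\ell_{i+1,j}$ for $1\le i\le p-1$, $1 \le j \le q$, and $b_{i,j}$ is adjacent to $t_{i,j+1}$ for $1\le i\le p$, $1\le j\le q-1$. There are no other edges. *)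

(* Defs.v *)
From HB Require Import structures.
From mathcomp Require Import all_boot.
Set Implicit Arguments.
Unset Strict Implicit.
Unset Printing Implicit Defensive.

Record sgraph := SGraph {
  vertex :> finType;
  adj : rel vertex;
  adj_sym : symmetric adj;
  adj_irrefl : irreflexive adj }.

Definition degree (H : sgraph) (u : H) : nat := #|[set v | adj u v]|.

Definition F_index (H : sgraph) : nat := \sum_(u : H) degree u ^ 3.

Definition is_edge (H : sgraph) (e : {set H}) : bool :=
  [exists u, exists v, adj u v && (e == [set u; v])].

Definition edge (H : sgraph) : finType := {e : {set H} | is_edge e}.

(* The original vertices are [inl u]; [inr e] is the vertex inserted into the
   edge [e], whose two neighbours are the endpoints of [e]. *)
Definition subdivision_adj (H : sgraph) : rel (H + edge H) :=
  fun x y => match x, y with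
  | inl u, inr e => u \in val e
  | inr e, inl u => u \in val e
  | _, _ => false
  end.

Lemma subdivision_adj_sym H : symmetric (@subdivision_adj H).
Proof. by move=> [u|e] [v|f]. Qed.

Lemma subdivision_adj_irrefl H : irreflexive (@subdivision_adj H).
Proof. by case. Qed.

Definition subdivision (H : sgraph) : sgraph :=
  SGraph (@subdivision_adj_sym H) (@subdivision_adj_irrefl H).

Definition line_adj (H : sgraph) : rel (edge H) :=
  fun e f => (e != f) && (val e :&: val f != set0).

Lemma line_adj_sym H : symmetric (@line_adj H).
Proof. by move=> e f; rewrite /line_adj eq_sym setIC. Qed.

Lemma line_adj_irrefl H : irreflexive (@line_adj H).
Proof. by move=> e; rewrite /line_adj eqxx. Qed.

Definition line_graph (H : sgraph) : sgraph :=
  SGraph (@line_adj_sym H) (@line_adj_irrefl H).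

Inductive corner := Left | Top | Right | Bottom.

Definition corner_to_ord (c : corner) : 'I_4 :=
  match c with
  | Left => @Ordinal 4 0 isT
  | Top => @Ordinal 4 1 isT
  | Right => @Ordinal 4 2 isT
  | Bottom => @Ordinal 4 3 isT
  end.

Definition ord_to_corner (k : 'I_4) : corner :=
  match val k with 0 => Left | 1 => Top | 2 => Right | _ => Bottom end.

Lemma corner_to_ordK : cancel corner_to_ord ord_to_corner.
Proof. by case. Qed.

HB.instance Definition _ := Finite.copy corner (can_type corner_to_ordK).

(* The vertex [(i, j, c)] is the corner [c] of the square in position [i] of
   row [j], with 0-based [i < p] and [j < q]. *)
Definition lattice_vertex (p q : nat) : finType :=
  ('I_p * 'I_q * corner)%type.

(* Each edge of the lattice, in exactly one of its two orientations. *)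
Definition lattice_arc (p q : nat) : rel (lattice_vertex p q) :=
  fun x y =>
  let: (i, j, c) := x in
  let: (i', j', c') := y in
  match c, c' with
  | Left, Top | Top, Right | Right, Bottom | Bottom, Left =>
      (i == i') && (j == j')
  | Right, Left => (i' == i.+1 :> nat) && (j == j')
  | Bottom, Top => (i == i') && (j' == j.+1 :> nat)
  | _, _ => false
  end.

Definition lattice_adj (p q : nat) : rel (lattice_vertex p q) :=
  fun x y => lattice_arc x y || lattice_arc y x.

Lemma lattice_adj_sym p q : symmetric (@lattice_adj p q).
Proof. by move=> x y; rewrite /lattice_adj orbC. Qed.

Lemma lattice_adj_irrefl p q : irreflexive (@lattice_adj p q).
Proof. by move=> [[i j] []]. Qed.

Definition TUC4C8_lattice (p q : nat) : sgraph :=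
  SGraph (@lattice_adj_sym p q) (@lattice_adj_irrefl p q).

(* Main.v *)
Require Import Defs.
From mathcomp Require Import all_boot all_order all_algebra.
From mathcomp Require Import zify.

(** Every edge of the subdivision graph [S(H)] joins an original vertex [u] to
    an inserted vertex, which has degree 2. In a line graph the edge [xy] has
    degree [d(x) + d(y) - 2], so in [L(S(H))] each edge at [u] has degree [d(u)].
    Since [u] keeps its degree in [S(H)], there are [d(u)] such edges, and
    [F(L(S(H)))] is the sum of the [d(u)^4] over the vertices [u] of [H]
    ([F_index_line_subdivision]). Everything up to this point holds for an
    arbitrary simple graph; it rests on the double reading of a degree as a
    number of neighbours and as a number of incident edges ([card_incident]).

    In the lattice, a corner of a square has degree 3 if another square lies
    on its side and degree 2 otherwise ([degree_lattice]). There are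
    [2p + 2q] corners of degree 2 among the [4pq], whence
    [81 (4pq - 2p - 2q) + 16 (2p + 2q) = 324pq - 130p - 130q]. *)

Set Implicit Arguments.
Unset Strict Implicit.
Unset Printing Implicit Defensive.

(** * Incident edges *)

Section IncidentEdges.
Variable H : sgraph.
Implicit Types (u v : H) (e f : edge H).

Definition incident u : {set edge H} := [set e : edge H | u \in val e].

Lemma adj_neq u v : adj u v -> u != v.
Proof. by apply: contraTneq => ->; rewrite adj_irrefl. Qed.

Lemma edgeP e : exists u v, adj u v /\ val e = [set u; v].
Proof.
by have /existsP[u /existsP[v /andP[uv /eqP e_uv]]] := valP e; exists u, v.
Qed.

Lemma card_edge e : #|val e| = 2.
Proof. by have [u [v [/adj_neq uv ->]]] := edgeP e; rewrite cards2 uv. Qed.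

Lemma edge_at e u : u \in val e -> exists2 v, adj u v & val e = [set u; v].
Proof.
have [x [y [xy e_xy]]] := edgeP e.
rewrite e_xy => /set2P[->|->]; first by exists y.
by exists x; rewrite 1?adj_sym // setUC.
Qed.

Lemma set2_inj u : injective (fun v => [set u; v]).
Proof.
move=> v w /= vw.
have /set2P[v_u|//] : v \in [set u; w] by rewrite -vw set22.
have /set2P[w_u|//] : w \in [set u; v] by rewrite vw set22.
by rewrite v_u w_u.
Qed.

(** An edge at [u] is determined by its other endpoint. *)
Lemma card_incident u : #|incident u| = degree u.
Proof.
rewrite -(card_imset _ val_inj) /degree -(card_imset _ (@set2_inj u)).
congr #|pred_of_set _|; apply/setP => A.
apply/imsetP/imsetP => [[e]|[v]]; rewrite inE.
  by move=> /edge_at[v uv e_uv] ->; exists v; rewrite ?inE.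
move=> uv ->.
have Euv : is_edge [set u; v].
  by apply/existsP; exists u; apply/existsP; exists v; rewrite uv eqxx.
by exists (Sub [set u; v] Euv); rewrite ?SubK // inE SubK set21.
Qed.

(** The edges meeting [e] at [x] and those meeting it at [y] form disjoint
    families: in a simple graph only [e] itself contains both endpoints. *)
Lemma degree_line e x y : adj x y -> val e = [set x; y] ->
  degree (e : line_graph H) = (degree x).-1 + (degree y).-1.
Proof.
move=> xy e_xy.
have -> : degree (e : line_graph H) =
    #|(incident x :\ e) :|: (incident y :\ e)|.
  congr #|pred_of_set _|; apply/setP => f.
  rewrite !inE /= /line_adj eq_sym -andb_orr; congr (_ && _).
  by rewrite e_xy setIUl setU_eq0 negb_and !setI_eq0 !disjoints1 !negbK.
rewrite cardsU [_ :&: _](_ : _ = set0) ?cards0 ?subn0.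
  rewrite -!card_incident (cardsD1 e (incident x)) (cardsD1 e (incident y)).
  by rewrite !inE e_xy set21 set22.
apply/setP => f; rewrite !inE; apply/negP => /andP[/andP[fe fx] /andP[_ fy]].
case/negP: fe; rewrite -val_eqE eq_sym eqEcard !card_edge leqnn andbT.
by rewrite e_xy subUset !sub1set fx.
Qed.

End IncidentEdges.

(** * Line graphs of subdivision graphs *)

Section LineSubdivision.
Variable H : sgraph.

Lemma degree_subdivision_inl (u : H) : degree (inl u : subdivision H) = degree u.
Proof.
rewrite -(card_incident u) -(card_imset _ (@inr_inj H (edge H))).
congr #|pred_of_set _|; apply/setP => -[v|e]; rewrite inE /=.
  by apply/esym/negbTE/imsetP => -[].
by rewrite (mem_imset _ _ (@inr_inj H (edge H))) inE.
Qed.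

Lemma degree_subdivision_inr (e : edge H) : degree (inr e : subdivision H) = 2.
Proof.
rewrite -(card_edge e) -(card_imset _ (@inl_inj H (edge H))).
congr #|pred_of_set _|; apply/setP => -[v|f]; rewrite inE /=.
  by rewrite (mem_imset _ _ (@inl_inj H (edge H))).
by apply/esym/negbTE/imsetP => -[].
Qed.

Lemma edge_subdivisionP (a : edge (subdivision H)) :
  exists u e, @adj (subdivision H) (inl u) (inr e) /\ val a = [set inl u; inr e].
Proof.
have [[u|e] [[v|f] [// xy a_xy]]] := edgeP a; first by exists u, f.
by exists v, e; rewrite a_xy setUC.
Qed.

Lemma degree_line_subdivision (a : edge (subdivision H)) (u : H) :
  inl u \in val a -> degree (a : line_graph (subdivision H)) = degree u.
Proof.
have [v [e [ve a_ve]]] := edge_subdivisionP a.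
rewrite a_ve => /set2P[[->]|//].
rewrite (degree_line ve a_ve) degree_subdivision_inl degree_subdivision_inr.
rewrite addn1 prednK // -card_incident card_gt0.
by apply/set0Pn; exists e; rewrite inE.
Qed.

(** The edges of [S(H)] are sorted by their unique original endpoint. *)
Lemma F_index_line_subdivision :
  F_index (line_graph (subdivision H)) = \sum_(u : H) degree u ^ 4.
Proof.
transitivity (\sum_(a : edge (subdivision H)) \sum_(u : H | inl u \in val a)
    degree u ^ 3).
  apply: eq_bigr => a _; have [u [e [_ a_ue]]] := edge_subdivisionP a.
  rewrite (@degree_line_subdivision _ u) ?a_ue ?set21 //.
  rewrite (big_pred1 u) // => v.
  by rewrite in_set2 orbF /=.
rewrite (exchange_big_dep xpredT) //=; apply: eq_bigr => u _.
rewrite sum_nat_const expnS; congr (_ * _).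
by rewrite -degree_subdivision_inl -card_incident cardsE.
Qed.

End LineSubdivision.

(** * Degrees in the lattice *)

Lemma sum_corner (F : corner -> nat) :
  \sum_c F c = F Left + F Top + F Right + F Bottom.
Proof.
rewrite (reindex ord_to_corner) /=.
  by rewrite !big_ord_recl big_ord0 addn0 !addnA.
exists corner_to_ord => [k _|c _]; last exact: corner_to_ordK.
by case: k => -[|[|[|[|]]]] // ?; apply: val_inj.
Qed.

Lemma sum_ord_eq n m : \sum_(i < n) (i == m :> nat) = (m < n).
Proof.
have [m_n|n_m] := ltnP m n.
  rewrite (bigD1 (Ordinal m_n)) //= eqxx big1 // => i.
  by rewrite -val_eqE /= => /negbTE ->.
by rewrite big1 // => i _; rewrite ltn_eqF // (leq_trans (ltn_ord i)).
Qed.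

Lemma sum_ord_eqS n (k : 'I_n) : \sum_(i < n) (k == i.+1 :> nat) = (0 < k).
Proof.
case: k => -[|k] k_n /=; first by rewrite big1.
under eq_bigr do rewrite eqSS eq_sym.
by rewrite sum_ord_eq ltnW.
Qed.

(** Expanding the sum over the three coordinates of a neighbour leaves, for
    each corner, its two neighbours in the square and a sum over one
    coordinate that tests whether the adjacent square exists. *)
Lemma degree_lattice p q (i : 'I_p) (j : 'I_q) (c : corner) :
  degree ((i, j, c) : TUC4C8_lattice p q) =
  2 + match c with
      | Left => 0 < i
      | Top => 0 < j
      | Right => i.+1 < p
      | Bottom => j.+1 < q
      end.
Proof.
have sumM (P : pred 'I_p) (Q : pred 'I_q) :
    \sum_k \sum_l (P k && Q l : nat) = (\sum_k P k) * (\sum_l Q l).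
  rewrite big_distrl; apply: eq_bigr => k _.
  by rewrite big_distrr; apply: eq_bigr => l _ /=; rewrite mulnb.
have sum1 n (k : 'I_n) : \sum_l (k == l : nat) = 1.
  under eq_bigr do rewrite eq_sym -val_eqE.
  by rewrite sum_ord_eq ltn_ord.
have sum1' n (k : 'I_n) : \sum_l (l == k : nat) = 1.
  by under eq_bigr do rewrite eq_sym; apply: sum1.
rewrite /degree -sum1dep_card big_mkcond /=.
pose A i' j' c' : nat := lattice_adj (i, j, c) (i', j', c').
transitivity (\sum_k \sum_l \sum_c' A k l c').
  rewrite pair_bigA pair_bigA /=; apply: eq_bigr => -[[k l] c'] _ /=.
  by rewrite /A; case: (lattice_adj _ _).
under eq_bigr do under eq_bigr do rewrite sum_corner.
rewrite {}/A /lattice_adj /=.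
case: c => /=; under eq_bigr do
  [under eq_bigr do rewrite ?orbF; rewrite !big_split /=];
  rewrite !big_split /= ?sumM ?sum1 ?sum1' ?sum_ord_eq ?sum_ord_eqS;
  rewrite !sum_nat_const; lia.
Qed.

(** Only the first square of a row or column lacks a neighbour on the near
    side; [sum_pow4_last] is the same count from the far side. *)
Lemma sum_pow4_first n : \sum_(i < n.+1) (2 + (0 < i)) ^ 4 = 16 + 81 * n.
Proof. by rewrite big_ord_recl /= sum_nat_const card_ord mulnC. Qed.

Lemma sum_pow4_last n : \sum_(i < n.+1) (2 + (i.+1 < n.+1)) ^ 4 = 16 + 81 * n.
Proof.
rewrite big_ord_recr /= ltnn addnC; congr (_ + _).
under eq_bigr do rewrite ltnS ltn_ord.
by rewrite sum_nat_const card_ord mulnC.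
Qed.

Lemma sum_degree4_lattice p q :
  \sum_(u : TUC4C8_lattice p.+1 q.+1) degree u ^ 4 =
  2 * q.+1 * (16 + 81 * p) + 2 * p.+1 * (16 + 81 * q).
Proof.
transitivity (\sum_(i < p.+1) \sum_(j < q.+1) \sum_(c : corner)
    degree ((i, j, c) : TUC4C8_lattice p.+1 q.+1) ^ 4).
  by rewrite pair_bigA pair_bigA; apply: eq_bigr => -[[]].
under eq_bigr do under eq_bigr do rewrite sum_corner !degree_lattice.
under eq_bigr do rewrite !big_split /= !sum_nat_const card_ord
  sum_pow4_first sum_pow4_last.
rewrite !big_split /= -!big_distrr /= !sum_nat_const card_ord.
rewrite sum_pow4_first sum_pow4_last; lia.
Qed.

Local Open Scope ring_scope.

Theorem theorem12 (p q : nat) (hp : (1 <= p)%N) (hq : (1 <= q)%N) :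
  (F_index (line_graph (subdivision (TUC4C8_lattice p q))))%:Z
  = 324%:Z * p%:Z * q%:Z - 130%:Z * p%:Z - 130%:Z * q%:Z.
Proof.
case: p q hp hq => [//|p] [//|q] _ _.
rewrite F_index_line_subdivision sum_degree4_lattice; lia.
Qed.
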